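(* Let $E$ and $B$ be finite $T_0$-spaces with $E\neq\varnothing$ and let $p\colon E\to B$ be a continuous map. Suppose, in addition, that $B$ has a minimum element. Then $p$ is a Hurewicz fibration if and only if the smallest dbp-retract of $p$ is a Grothendieck bifibration.
   Context: A finite $T_0$-space $X$ is regarded as a poset via $x\leq y$ iff $U_x\subseteq U_y$, where $U_a$ is the smallest open set containing $a$; a poset is regarded as a small category (with one arrow $x\to y$ exactly when $x\leq y$), and continuous (i.e. order-preserving) maps as functors. A point $a\in X$ is a down beat point of $X$ if $\{x: x<a\}$ has a maximum element. For a continuous map $p\colon E\to B$ between finite $T_0$-spaces, $e\in E$ is a down beat point of $p$ if it is a down beat point of both $E$ and the fiber $p^{-1}(p(e))$; removing it means replacing $p$ by its restriction $E-\{e\}\to B$. A dbp-retract of $p$ is a restriction $p'\colon E'\to B$ of $p$ obtained by successively removing (finitely many, possibly zero) down beat points, each being a down beat point of the map at that stage. The set of dbp-retracts of $p$ is partially ordered by: $x\leq y$ iff $x$ is a dbp-retract of $y$. This poset has a minimum element, called the smallest dbp-retract of $p$. A Hurewicz fibration is a continuous map with the homotopy lifting property with respect to all topological spaces. A functor $p\colon E\to B$ between small categories is a Grothendieck fibration if for all $e\in E$ and all arrows $f\colon b\to p(e)$ of $B$ there is a cartesian arrow $\tilde f\colon e'\to e$ of $E$ with $p(\tilde f)=f$; here an arrow $f\colon e'\to e$ is cartesian if for all $g\colon e''\to e$ in $E$ and $h\colon p(e'')\to p(e')$ in $B$ with $p(g)=p(f)h$ there is a unique $\tilde h\colon e''\to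 e'$ with $f\tilde h=g$ and $p(\tilde h)=h$. It is a Grothendieck opfibration if $p^{\mathrm{op}}$ is a Grothendieck fibration, and a Grothendieck bifibration if it is both. *)

(* Defs.v *)
From HB Require Import structures.
From mathcomp Require Import all_boot all_order all_algebra.
From mathcomp Require Import finmap all_classical all_reals.
From mathcomp Require Import topology normedtype.

Set Implicit Arguments.
Unset Strict Implicit.
Unset Printing Implicit Defensive.

Import Order.TTheory GRing.Theory Num.Theory.
Import numFieldTopology.Exports.

Local Open Scope classical_set_scope.
Local Open Scope ring_scope.

Record category := Category {
  obj : Type;
  hom : obj -> obj -> Type;
  idm : forall x, hom x x;
  comp : forall x y z, hom y z -> hom x y -> hom x z;
  comp_idl : forall x y (f : hom x y), comp (idm y) f = f;
  comp_idr : forall x y (f : hom x y), comp f (idm x) = f;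
  comp_assoc : forall x y z w (f : hom z w) (g : hom y z) (h : hom x y),
    comp f (comp g h) = comp (comp f g) h }.

Arguments hom : clear implicits.
Arguments idm : clear implicits.
Arguments comp {c x y z}.

Definition opposite (C : category) : category :=
  @Category (obj C) (fun x y => hom C y x) (idm C)
    (fun x y z f g => comp g f)
    (fun x y f => comp_idr f) (fun x y f => comp_idl f)
    (fun x y z w f g h => esym (comp_assoc h g f)).

Record functor (C D : category) := Functor {
  fobj :> obj C -> obj D;
  fmap : forall x y, hom C x y -> hom D (fobj x) (fobj y);
  fmap_id : forall x, fmap (idm C x) = idm D (fobj x);
  fmap_comp : forall x y z (f : hom C y z) (g : hom C x y),
    fmap (comp f g) = comp (fmap f) (fmap g) }.

Arguments fmap {C D} _ {x y}.

Definition opposite_functor (C D : category) (p : functor C D) :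
    functor (opposite C) (opposite D) :=
  @Functor (opposite C) (opposite D) p (fun x y f => fmap p f)
    (fun x => fmap_id p x) (fun x y z f g => fmap_comp p g f).

Definition cartesian (C D : category) (p : functor C D) (e' e : obj C)
    (f : hom C e' e) : Prop :=
  forall (e'' : obj C) (g : hom C e'' e) (h : hom D (p e'') (p e')),
    fmap p g = comp (fmap p f) h ->
    exists! ht : hom C e'' e', comp f ht = g /\ fmap p ht = h.

(* The equality [fmap p ft = f] only typechecks once [p e'] is identified with
   [b]; [eq_rect] transports [fmap p ft] along that identification. *)
Definition grothendieck_fibration (C D : category) (p : functor C D) : Prop :=
  forall (e : obj C) (b : obj D) (f : hom D b (p e)),
    exists (e' : obj C) (pe' : p e' = b) (ft : hom C e' e),
      cartesian p ft /\
      eq_rect (p e') (fun x => hom D x (p e)) (fmap p ft) b pe' = f.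

Definition grothendieck_opfibration (C D : category) (p : functor C D) : Prop :=
  grothendieck_fibration (opposite_functor p).

Definition grothendieck_bifibration (C D : category) (p : functor C D) : Prop :=
  grothendieck_fibration p /\ grothendieck_opfibration p.

(* When [T] is finite this intersection is open, so it is the smallest open
   set containing [a]. *)
Definition min_open (T : topologicalType) (a : T) : set T :=
  \bigcap_(U in [set U : set T | open U /\ U a]) U.

Definition space_le (T : topologicalType) (x y : T) : Prop :=
  min_open x `<=` min_open y.

Definition space_lt (T : topologicalType) (x y : T) : Prop :=
  space_le x y /\ x <> y.

Lemma space_le_refl (T : topologicalType) (x : T) : space_le x x.
Proof. by []. Qed.

Lemma space_le_trans (T : topologicalType) (x y z : T) :
  space_le y z -> space_le x y -> space_le x z.
Proof. by move=> yz xy; apply: subset_trans yz. Qed.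

Definition space_category (T : topologicalType) : category :=
  @Category T (fun x y => space_le x y) (@space_le_refl T) (@space_le_trans T)
    (fun x y f => Prop_irrelevance _ _) (fun x y f => Prop_irrelevance _ _)
    (fun x y z w f g h => Prop_irrelevance _ _).

Lemma space_leP (T : topologicalType) (x y : T) :
  space_le x y <-> forall U : set T, open U -> U y -> U x.
Proof.
split=> [xy U oU Uy|H z zx U [oU Uy]]; last by apply: zx; split=> //; exact: H.
by have /xy : min_open x x by [move=> V []]; apply.
Qed.

Lemma continuous_space_le (E B : topologicalType) (p : E -> B) :
  continuous p -> forall x y, space_le x y -> space_le (p x) (p y).
Proof.
move=> /continuousP pc x y /space_leP xy; apply/space_leP => U oU.
exact: (xy (p @^-1` U) (pc _ oU)).
Qed.

Definition space_functor (E B : topologicalType) (p : E -> B)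
    (pc : continuous p) : functor (space_category E) (space_category B) :=
  @Functor (space_category E) (space_category B) p
    (continuous_space_le pc)
    (fun x => @Prop_irrelevance (space_le (p x) (p x)) _ _)
    (fun x y z f g => @Prop_irrelevance (space_le (p x) (p z)) _ _).

Definition down_beat_point (T : topologicalType) (a : T) : Prop :=
  exists m : T, space_lt m a /\ forall x : T, space_lt x a -> space_le x m.

(* Subsets, coerced to types, carry the subspace topology. *)
Definition fiber (E B : topologicalType) (p : E -> B) (b : B) : set E :=
  p @^-1` [set b].

Definition fiber_point (E B : topologicalType) (p : E -> B) (e : E) :
    fiber p (p e) :=
  exist _ e (mem_set (erefl (p e) : fiber p (p e) e)).

Definition map_down_beat_point (E B : topologicalType) (p : E -> B) (e : E) :
    Prop :=
  down_beat_point e /\ down_beat_point (fiber_point p e).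

Definition restr (E B : topologicalType) (p : E -> B) (A : set E) : A -> B :=
  fun x => p (set_val x).
Arguments restr {E B} p A x.

Lemma restr_continuous (E B : topologicalType) (p : E -> B) (A : set E) :
  continuous p -> continuous (restr p A).
Proof.
move=> pc x; apply: continuous_comp; last exact: pc.
exact: initial_continuous.
Qed.
Arguments restr_continuous {E B p} A _.

(* [dbp_retract p A A'] : the restriction of [p] to [A'] is a dbp-retract of the
   restriction of [p] to [A]; [A `\ a] is [A] minus the point [a]. *)
Inductive dbp_retract (E B : topologicalType) (p : E -> B) (A : set E) :
    set E -> Prop :=
| dbp_retract_refl : dbp_retract p A A
| dbp_retract_step (A' : set E) (e : A') :
    dbp_retract p A A' -> map_down_beat_point (restr p A') e ->
    dbp_retract p A (A' `\ set_val e).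

Definition is_smallest_dbp_retract (E B : topologicalType) (p : E -> B)
    (A : set E) : Prop :=
  dbp_retract p setT A /\
  forall A' : set E, dbp_retract p setT A' -> dbp_retract p A' A.

(* The domain of the smallest dbp-retract. The default value [setT] of [xget] is
   never used for a finite T0 domain: see [smallest_dbp_retractP] below. *)
Definition smallest_dbp_retract (E B : topologicalType) (p : E -> B) : set E :=
  xget setT [set A | is_smallest_dbp_retract p A].

Lemma dbp_retract_sub (E B : topologicalType) (p : E -> B) (A A' : set E) :
  dbp_retract p A A' -> A' `<=` A.
Proof. by elim=> // A1 e _ IH _ x [/IH]. Qed.

Lemma is_smallest_dbp_retract_unique (E B : topologicalType) (p : E -> B)
    (A A' : set E) :
  is_smallest_dbp_retract p A -> is_smallest_dbp_retract p A' -> A = A'.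
Proof.
move=> [dA hA] [dA' hA']; apply/seteqP; split.
  exact: (dbp_retract_sub (hA _ dA')).
exact: (dbp_retract_sub (hA' _ dA)).
Qed.

Section SmallestDbpRetract.
Context (E B : topologicalType) (p : E -> B).
Context (finE : finite_set [set: E]) (T0E : kolmogorov_space E).

Let le_anti (x y : E) : space_le x y -> space_le y x -> x = y.
Proof.
move=> /space_leP xy /space_leP yx; apply: contrapT => /eqP nxy.
have [A] := T0E nxy; rewrite !inE => -[] [].
  rewrite nbhsE => -[U [oU Ux] UA] nAy; apply: nAy; apply: UA; exact: yx.
rewrite nbhsE => -[U [oU Uy] UA] nAx; apply: nAx; apply: UA; exact: xy.
Qed.

Lemma space_le_val (T : topologicalType) (A : set T) (x y : A) :
  space_le x y <-> space_le (set_val x) (set_val y).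
Proof.
split=> /space_leP xy; apply/space_leP => U oU.
  by apply: (xy (set_val @^-1` U)) => //; exists U.
by case: oU => V oV <- /= Vy; exact: xy.
Qed.

Let dbp (A : set E) (e : E) :=
  exists m, [/\ A m, space_lt m e & forall x, A x -> space_lt x e -> space_le x m].

Let gen_dbp (T : topologicalType) (f : T -> E) (a : T) :
  injective f -> (forall x y, space_le x y <-> space_le (f x) (f y)) ->
  down_beat_point a = dbp (range f) (f a).
Proof.
move=> finj fle; apply: propext.
have flt x y : space_lt x y <-> space_lt (f x) (f y).
  split=> -[h n]; split; first exact/fle.
  - by move=> /finj.
  - exact/fle.
  - by move=> xy; apply: n; rewrite xy.
split=> [[m [ma mm]]|[_ [[m _ <-] ma mm]]].
  exists (f m); split; [by exists m|exact/flt|].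
  by move=> _ [x _ <-] /flt /mm /fle.
exists m; split; first exact/flt.
move=> x /flt xa; apply/fle; apply: mm => //; by exists x.
Qed.

Let map_dbpE (A : set E) (e : A) :
  map_down_beat_point (restr p A) e <->
  dbp A (set_val e) /\ dbp (A `&` p @^-1` [set p (set_val e)]) (set_val e).
Proof.
pose f (x : fiber (restr p A) (restr p A e)) : E := set_val (set_val x).
rewrite /map_down_beat_point (@gen_dbp _ (set_val : A -> E)); last 2 first.
- by move=> x y /val_inj.
- by move=> x y; exact: space_le_val.
rewrite (@gen_dbp _ f); last 2 first.
- by move=> x y /val_inj /val_inj.
- by move=> x y; apply: iff_trans (space_le_val _ _) (space_le_val _ _).
have -> : range (set_val : A -> E) = A.
  apply/seteqP; split=> [_ [x _ <-]|x Ax]; first exact: set_valP.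
  by exists (exist _ x (mem_set Ax)).
suff -> : range f = A `&` p @^-1` [set p (set_val e)] by [].
apply/seteqP; split=> [_ [x _ <-]|x [Ax px]].
  split; first exact: set_valP.
  exact: (set_valP x).
have Fx : fiber (restr p A) (restr p A e) (exist _ x (mem_set Ax)).
  exact: px.
pose y : fiber (restr p A) (restr p A e) :=
  exist _ (exist _ x (mem_set Ax)) (mem_set Fx).
by exists y.
Qed.

Let dbp_stable (A : set E) (d e : E) :
  dbp A d -> dbp A e -> e <> d -> dbp (A `\ d) e.
Proof.
move=> [n [An [nd nnd] nm]] [m [Am [me nme] mm]] ned.
have [md|md] := pselect (m = d); last first.
  by exists m; split=> // x [Ax _]; exact: mm.
subst m; have nle := space_le_trans me nd.
exists n; split=> //.
- split=> // nE; apply: nme; apply: le_anti => //; by rewrite -nE.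
- move=> x [Ax xd] xe; apply: nm => //; split=> //; exact: mm.
Qed.

Let mdbp (A : set E) (e : E) :=
  [/\ A e, dbp A e & dbp (A `&` p @^-1` [set p e]) e].

Let mdbp_step (A A' : set E) (e : E) :
  dbp_retract p A A' -> mdbp A' e -> dbp_retract p A (A' `\ e).
Proof.
move=> AA' [Ae d1 d2]; pose e' : A' := exist _ e (mem_set Ae).
have -> : e = set_val e' by [].
by apply: dbp_retract_step => //; apply/map_dbpE.
Qed.

Let dbp_retract_trans (A1 A2 A3 : set E) :
  dbp_retract p A1 A2 -> dbp_retract p A2 A3 -> dbp_retract p A1 A3.
Proof.
move=> h12; elim=> // A e _ IH he; exact: dbp_retract_step.
Qed.

Let mdbp_stable (A : set E) (d e : E) :
  mdbp A d -> mdbp A e -> e <> d -> mdbp (A `\ d) e.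
Proof.
move=> [Ad d1 d2] [Ae e1 e2] ned; split=> //; first exact: dbp_stable.
have [pde|pde] := pselect (p d = p e).
  have -> : (A `\ d) `&` p @^-1` [set p e] = (A `&` p @^-1` [set p e]) `\ d.
    by rewrite !setDE setIAC.
  by apply: dbp_stable => //; rewrite -pde.
suff -> : (A `\ d) `&` p @^-1` [set p e] = A `&` p @^-1` [set p e] by [].
apply/seteqP; split=> x; first by move=> [[]].
move=> [Ax px]; split=> //; split=> // xd; apply: pde; by rewrite -xd.
Qed.

Let setD1_id (A : set E) (e : E) : ~ A e -> A `\ e = A.
Proof.
move=> nAe; apply/seteqP; split=> x; first by case.
by move=> Ax; split=> // xe; apply: nAe; rewrite -xe.
Qed.

Let dbp_retract_strip (A A' : set E) (e : E) :
  dbp_retract p A A' -> mdbp A e ->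
  (mdbp A' e \/ ~ A' e) /\ dbp_retract p (A `\ e) (A' `\ e).
Proof.
move=> AA' he; elim: AA' => [|A1 d AA1 [h1 h2] /map_dbpE hd].
  by split; [left|exact: dbp_retract_refl].
have {hd}md : mdbp A1 (set_val d) by case: hd; split=> //; exact: set_valP.
have [de|nde] := pselect (set_val d = e).
  rewrite de (@setD1_id (A1 `\ e)); last by case=> _; apply.
  by split=> //; right=> -[_]; apply.
have ned : e <> set_val d by move=> ed; apply: nde.
rewrite setDDl setUC -setDDl; case: h1 => [me|nA1e].
  split; first by left; exact: mdbp_stable.
  by apply: mdbp_step => //; exact: mdbp_stable.
split; first by right=> -[].
by move: h2; rewrite (setD1_id nA1e) => h2; exact: mdbp_step.
Qed.

Let dbp_retract_terminal (A A' M : set E) :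
  dbp_retract p A A' -> dbp_retract p A M -> (forall e, ~ mdbp M e) ->
  dbp_retract p A' M.
Proof.
move=> AA' AM tM; elim: AA' => // A1 d AA1 A1M /map_dbpE hd.
have md : mdbp A1 (set_val d) by case: hd; split=> //; exact: set_valP.
have [[/tM//|nMd]] := dbp_retract_strip A1M md.
by rewrite (setD1_id nMd).
Qed.

Let terminal_exists (A : set E) :
  exists2 M, dbp_retract p A M & forall e, ~ mdbp M e.
Proof.
have fin (A0 : set E) : finite_set A0 by exact: sub_finite_set finE.
have [n] := ubnP #|` fset_set A|; elim: n A => // n IH A cA.
have [[e me]|ne] := pselect (exists e, mdbp A e); last first.
  by exists A; [exact: dbp_retract_refl|move=> e me; apply: ne; exists e].
have [|M AM tM] := IH (A `\ e).
  move: cA; rewrite ltnS; apply: leq_trans; apply: fproper_ltn_card.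
  case: (me) => Ae _ _; rewrite fproperEneq; apply/andP; split.
    apply/eqP => /(congr1 (fun X => e \in X)).
    rewrite !in_fset_set// (mem_set Ae) => /set_mem [_]; exact.
  by apply/fsubsetP => x; rewrite !in_fset_set// !inE => -[].
exists M => //; apply: dbp_retract_trans AM; apply: mdbp_step => //.
exact: dbp_retract_refl.
Qed.

Lemma smallest_dbp_retractP :
  is_smallest_dbp_retract p (smallest_dbp_retract p).
Proof.
have [M TM tM] := terminal_exists setT.
rewrite /smallest_dbp_retract; case: xgetP => // /(_ M) []; split=> //.
by move=> A' TA'; exact: dbp_retract_terminal TM tM.
Qed.

End SmallestDbpRetract.

Definition unit_interval (R : realType) : set R := `[0, 1]%classic.
Arguments unit_interval R : clear implicits.

Lemma unit_interval_0 (R : realType) : unit_interval R 0.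
Proof. by rewrite /unit_interval /= in_itv /= lexx ler01. Qed.

Definition unit_interval0 (R : realType) : unit_interval R :=
  exist _ 0 (mem_set (unit_interval_0 R)).

Definition homotopy_lifting_property (R : realType) (E B : topologicalType)
    (p : E -> B) (X : topologicalType) : Prop :=
  forall (f : X -> E) (H : X * unit_interval R -> B),
    continuous f -> continuous H ->
    (forall x, H (x, unit_interval0 R) = p (f x)) ->
    exists G : X * unit_interval R -> E,
      [/\ continuous G,
          forall x, G (x, unit_interval0 R) = f x &
          forall z, p (G z) = H z].

(* [topologicalType] includes a choice structure, which every type has
   classically, so [X] is an arbitrary, possibly empty, topological space. *)
Definition hurewicz_fibration (R : realType) (E B : topologicalType)
    (p : E -> B) : Prop :=
  continuous p /\
  forall X : topologicalType, homotopy_lifting_property R p X.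

(* Main.v *)
Require Import Defs.
From HB Require Import structures.
From mathcomp Require Import all_boot all_order all_algebra.
From mathcomp Require Import finmap all_classical all_reals.
From mathcomp Require Import topology normedtype sequences.

(** In a finite space open sets are down-sets, so a homotopy may jump downwards
    right after time 0.  Over a base with minimum [b0], both sides of the
    equivalence amount to the existence of a monotone [s : E -> B -> E] with
    [p (s e b) = b] and [s e (p e) <= e].  Such an [s] lifts a homotopy [H]
    starting at [p \o f] by [f] at time 0 and [s (f x) (H (x, t))] afterwards.
    Conversely, [s] is read off at one instant of a lift over a test space in
    which the homotopy drops to [b0] at once and reaches [b] at a time [1/n];
    points where the homotopy is constant keep the lift below its start.
    Removing down beat points retracts [E] downwards over [B] and transports
    [s].  Once there are none left, a map decreasing over [B] is the identity,
    so [s e (p e) = e]; then [s e b] is both the cartesian and the opcartesian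
    lift.  A bifibration yields [s e b] by pulling [e] back to [b0] and pushing
    the result forward to [b]. *)

Set Implicit Arguments.
Unset Strict Implicit.
Unset Printing Implicit Defensive.

Import Order.TTheory GRing.Theory Num.Theory.
Import numFieldTopology.Exports.

Local Open Scope classical_set_scope.
Local Open Scope ring_scope.

(** * Order and continuity in finite spaces *)

Section FiniteSpaces.

Lemma filter_forall_finite (I T : Type) (F : set_system T) (P : I -> set T) :
  Filter F -> finite_set [set: I] -> (forall i, F (P i)) ->
  F [set x | forall i, P i x].
Proof.
move=> FF finI FP; elim/Pchoice: I => I in finI P FP *.
have := @filter_bigI T I (fset_set setT) P F FF (fun i _ => FP i).
by apply: filterS => x Px i; apply: Px; rewrite /= in_fset_set// in_setT.
Qed.

Lemma space_le_anti (T : topologicalType) (x y : T) :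
  kolmogorov_space T -> space_le x y -> space_le y x -> x = y.
Proof.
move=> T0 /space_leP xy /space_leP yx; apply: contrapT => /eqP nxy.
have [A] := T0 x y nxy; rewrite !inE nbhsE /= => -[] [].
  by move=> [U [oU Ux] UA] nAy; apply: nAy; apply: UA; exact: yx.
by rewrite nbhsE => -[U [oU Uy] UA] nAx; apply: nAx; apply: UA; exact: xy.
Qed.

Lemma near_space_le (T : topologicalType) (x : T) :
  finite_set [set: T] -> \forall y \near x, space_le y x.
Proof.
move=> finT.
(* Each [z] not below [x] is missed by some open neighborhood of [x]; finiteness allows intersecting
   these neighborhoods. *)
suff : \forall y \near x, forall z, space_le z x \/ y <> z.
  by apply: filterS => y /(_ y) [].
apply: filter_forall_finite => // z.
have [zx|] := pselect (space_le z x); first by apply: nearW; left.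
move=> /space_leP/existsNP[U /not_implyP[oU /not_implyP[Ux nUz]]].
have : nbhs x U by exact: open_nbhs_nbhs.
by apply: filterS => y Uy; right=> yz; apply: nUz; rewrite -yz.
Qed.

Lemma continuous_near_le (S T : topologicalType) (f : S -> T) :
  (forall x, \forall y \near x, space_le (f y) (f x)) -> continuous f.
Proof.
move=> fle x A; rewrite nbhs_simpl /= nbhsE => -[U [oU Ux] UA].
by apply: filterS (fle x) => y /space_leP/(_ U oU Ux)/UA.
Qed.

Lemma continuous_near_space_le (S T : topologicalType) (f : S -> T) :
  finite_set [set: T] -> continuous f ->
  forall x, \forall y \near x, space_le (f y) (f x).
Proof. by move=> finT fc x; exact: fc (near_space_le (f x) finT). Qed.

End FiniteSpaces.

(** * Slices of continuous maps on a product *)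

Lemma continuous_slicel (S T U : topologicalType) (f : S * T -> U) (y : T) :
  continuous f -> continuous (fun x => f (x, y)).
Proof.
move=> fc x; apply: (@cvg_comp _ _ _ (fun x => (x, y)) f _ (nbhs (x, y))).
  apply: (@cvg_pair _ _ _ (nbhs x) (nbhs x) (nbhs y)); first exact: cvg_id.
  exact: cvg_cst.
exact: fc.
Qed.

Lemma continuous_slicer (S T U : topologicalType) (f : S * T -> U) (x : S) :
  continuous f -> continuous (fun y => f (x, y)).
Proof.
move=> fc y; apply: (@cvg_comp _ _ _ (fun y => (x, y)) f _ (nbhs (x, y))).
  apply: (@cvg_pair _ _ _ (nbhs y) (nbhs x) (nbhs y)); first exact: cvg_cst.
  exact: cvg_id.
exact: fc.
Qed.

(* The relation is a parameter of the alias only so that the instances below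
   can find it. *)
Definition alexandrov (T : Type) (le : T -> T -> Prop) : Type := T.

(** * The topology of down-closed sets *)

Section Alexandrov.
Context {T : Type} (le : T -> T -> Prop).

Definition alexandrov_open (U : set T) := forall x y, le x y -> U y -> U x.

Lemma alexandrov_openT : alexandrov_open setT.
Proof. by []. Qed.

Lemma alexandrov_openI : setI_closed alexandrov_open.
Proof. by move=> U V oU oV x y xy [/(oU _ _ xy) ? /(oV _ _ xy)]. Qed.

Lemma alexandrov_open_bigU (I : Type) (U : I -> set T) :
  (forall i, alexandrov_open (U i)) -> alexandrov_open (\bigcup_i U i).
Proof. by move=> oU x y xy [i _ /(oU i _ _ xy) Ux]; exists i. Qed.

HB.instance Definition _ := gen_eqMixin (alexandrov le).
HB.instance Definition _ := gen_choiceMixin (alexandrov le).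
HB.instance Definition _ := @isOpenTopological.Build (alexandrov le)
  alexandrov_open alexandrov_openT alexandrov_openI alexandrov_open_bigU.

Lemma alexandrov_space_le (x y : alexandrov le) : le x y -> space_le x y.
Proof. by move=> xy; apply/space_leP => U oU; exact: oU. Qed.

Lemma near_alexandrov (x : alexandrov le) :
  (forall y, le y y) -> (forall y z w, le y z -> le z w -> le y w) ->
  \forall y \near x, le y x.
Proof.
move=> le_refl le_trans; apply: open_nbhs_nbhs; split; last exact: le_refl.
by move=> y z yz zx; exact: le_trans zx.
Qed.

Lemma alexandrov_continuous (T' : topologicalType) (f : alexandrov le -> T') :
  (forall x y, le x y -> space_le (f x) (f y)) -> continuous f.
Proof.
move=> fle; apply/continuousP => U oU.
suff : alexandrov_open (f @^-1` U) by [].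
by move=> x y /fle/space_leP; apply.
Qed.

(** The down-set of [x] is a neighborhood of [x], and monotonicity bounds every slice over it by the
    slice at [x]; so control in each variable separately gives joint continuity. *)
Lemma alexandrov_prod_continuous (S T' : topologicalType)
    (f : alexandrov le * S -> T') :
  (forall x, le x x) -> (forall x y z, le x y -> le y z -> le x z) ->
  (forall x y u, le x y -> space_le (f (x, u)) (f (y, u))) ->
  (forall x u, \forall v \near u, space_le (f (x, v)) (f (x, u))) ->
  continuous f.
Proof.
move=> le_refl le_trans fle fnear; apply: continuous_near_le => -[x u].
exists ([set y | le y x], [set v | space_le (f (x, v)) (f (x, u))]).
  by split; [exact: near_alexandrov|exact: fnear].
by move=> [y v] [/= yx vu]; apply: space_le_trans vu _; exact: fle.
Qed.

End Alexandrov.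

(** * Neighborhoods in the unit interval *)

Lemma near_unit_interval_gt (R : realType) (t : unit_interval R) (a : R) :
  a < set_val t -> \forall u \near t, a < set_val u.
Proof.
by move=> ta; exact: (@initial_continuous _ _ _ t _ (lt_nbhsr ta)).
Qed.

Lemma near_unit_interval_lt (R : realType) (t : unit_interval R) (a : R) :
  set_val t < a -> \forall u \near t, set_val u < a.
Proof.
by move=> ta; exact: (@initial_continuous _ _ _ t _ (lt_nbhsl ta)).
Qed.

Lemma unit_interval_ge0 (R : realType) (t : unit_interval R) : 0 <= set_val t.
Proof. by have := set_valP t; rewrite /unit_interval /= in_itv /= => /andP[]. Qed.

Lemma unit_interval_eq0 (R : realType) (t : unit_interval R) :
  set_val t = 0 -> t = unit_interval0 R.
Proof. by move=> t0; exact: val_inj. Qed.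

(** * From a transport to homotopy lifting *)

Section Transport.
Context {E B : topologicalType} (p : E -> B).

(** An order-theoretic path-lifting function: [s e b] carries [e] to the fiber over [b]. The last
    clause is an inequality because a lift may drop right after time 0. *)
Definition transport (s : E -> B -> E) : Prop :=
  [/\ forall e e' b b', space_le e e' -> space_le b b' ->
        space_le (s e b) (s e' b'),
      forall e b, p (s e b) = b &
      forall e, space_le (s e (p e)) e].

Lemma transport_hurewicz_fibration (R : realType) (s : E -> B -> E) :
  finite_set [set: E] -> finite_set [set: B] -> continuous p -> transport s ->
  hurewicz_fibration R p.
Proof.
move=> finE finB pc [s_le ps s_counit]; split=> // X f H fc Hc H0.
pose G z := if set_val z.2 == 0 then f z.1 else s (f z.1) (H z).
have val0 : set_val (unit_interval0 R) = 0 by [].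
exists G; split=> [|x|[x t]]; first last.
- rewrite /G /=; case: eqP => [/unit_interval_eq0 ->|_]; last exact: ps.
  by rewrite H0.
- by rewrite /G /= val0 eqxx.
(* Raising the values on the closed set [t = 0] preserves continuity, since open
   sets are down-sets. *)
apply: continuous_near_le => -[x t].
have nearf : \forall z \near (x, t), space_le (f z.1) (f x).
  exact: (@cvg_fst _ _ (nbhs x) (nbhs t) _ _ (continuous_near_space_le finE fc x)).
have nearH := continuous_near_space_le finB Hc (x, t).
have G_le z : space_le (f z.1) (f x) -> space_le (H z) (H (x, t)) ->
    set_val z.2 != 0 -> space_le (G z) (s (f x) (H (x, t))).
  by rewrite /G => fz Hz /negPf ->; exact: s_le.
have [t0|tn0] := eqVneq (set_val t) 0.
  apply: filterS2 nearf nearH => z fz Hz.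
  have Gxt : G (x, t) = f x by rewrite /G /= t0 eqxx.
  rewrite Gxt; have [z0|zn0] := eqVneq (set_val z.2) 0.
    by rewrite /G z0 eqxx.
  (* Leaving time 0: [H (x, t)] is [p (f x)], so the bound from [G_le] is itself below [f x]. *)
  apply: space_le_trans (s_counit _) _; move: (G_le z fz Hz zn0).
  by rewrite (unit_interval_eq0 t0) H0.
have t_gt0 : 0 < set_val t by rewrite lt_neqAle eq_sym tn0 unit_interval_ge0.
have near0 : \forall z \near (x, t), 0 < set_val z.2.
  exact: (@cvg_snd _ _ (nbhs x) (nbhs t) _ _ (near_unit_interval_gt t_gt0)).
apply: filterS3 nearf nearH near0 => z fz Hz z0.
by rewrite {2}/G /= (negPf tn0); apply: G_le => //; rewrite gt_eqF.
Qed.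

End Transport.

(** * From homotopy lifting to a transport *)

Section TestSpace.
Context {E B : topologicalType} (p : E -> B).

(* For every [n], [Moving e b n] is below [Fixed e'] whenever [e <= e'] and
   [b <= p e'], so one neighborhood of [(Fixed e', 0)] bounds the lift at
   [(Moving e b n, 1/(n+1))] for all large [n]. *)
Inductive test_point := Moving (e : E) (b : B) (n : nat) | Fixed (e : E).

(** The clauses make the homotopy monotone: [space_le b (p e')] keeps the final value [b] below the
    constant value at [Fixed e'], and [n = n'] makes comparable moving points jump at the same
    time. *)
Definition test_le (x y : test_point) : Prop :=
  match x, y with
  | Moving e b n, Moving e' b' n' => [/\ space_le e e', space_le b b' & n = n']
  | Moving e b _, Fixed e' => space_le e e' /\ space_le b (p e')
  | Fixed e, Fixed e' => space_le e e'
  | Fixed _, Moving _ _ _ => False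
  end.

Lemma test_le_refl x : test_le x x.
Proof.
case: x => [e b n|e]; last exact: space_le_refl.
by split=> //; exact: space_le_refl.
Qed.

Lemma test_le_trans (pc : continuous p) x y z :
  test_le x y -> test_le y z -> test_le x z.
Proof.
have tr (T : topologicalType) (a b c : T) :
  space_le a b -> space_le b c -> space_le a c.
  by move=> ab bc; exact: space_le_trans bc ab.
case: x y z => [e b n|e] [e' b' n'|e'] [e'' b'' n''|e''] //=.
- by move=> [? ? ->] [? ? ->]; split; [exact: (tr _ _ e')|exact: (tr _ _ b')|].
- by move=> [? ? _] [? ?]; split; [exact: (tr _ _ e')|exact: (tr _ _ b')].
- move=> [ee' be'] e'e''; split; first exact: tr ee' _.
  by apply: tr be' _; exact: continuous_space_le.
- exact: tr.
Qed.

Definition test_value (x : test_point) : E :=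
  match x with Moving e _ _ => e | Fixed e => e end.

(** The intermediate value [b0] lies below both [p e] and [b], so the higher values are taken on the
    closed sets [{0}] and [[1/(n+1), 1]], as continuity requires. The strict comparison with
    [harmonic n], which is [1/(n+1)], makes [b] attained at that very instant. *)
Definition test_homotopy (R : realType) (b0 : B)
    (z : alexandrov test_le * unit_interval R) : B :=
  match z.1 with
  | Moving e b n =>
      if set_val z.2 == 0 then p e
      else if set_val z.2 < harmonic n then b0 else b
  | Fixed e => p e
  end.

Lemma test_homotopy_continuous (R : realType) (b0 : B) :
  continuous p -> (forall b, space_le b0 b) ->
  continuous (@test_homotopy R b0).
Proof.
move=> pc b0_min; have pm := continuous_space_le pc.
apply: alexandrov_prod_continuous.
- exact: test_le_refl.
- exact: test_le_trans.
- move=> [e b n|e] [e' b' n'|e'] t //=; rewrite /test_homotopy /=.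
  + move=> [ee' bb' ->]; case: ifP => _; first exact: pm.
    by case: ifP => // _; exact: space_le_refl.
  + move=> [ee' be']; case: ifP => _; first exact: pm.
    by case: ifP => // _; exact: b0_min.
  + exact: pm.
- move=> [e b n|e] t; rewrite /test_homotopy /=; last first.
    by apply: (@filterE _ (nbhs t)) => u; exact: space_le_refl.
  have [t0|tn0] := eqVneq (set_val t) 0.
    have /near_unit_interval_lt : set_val t < harmonic n.
      by rewrite t0 harmonic_gt0.
    apply: filterS => u un; rewrite un; case: ifP => _; [exact: space_le_refl|].
    exact: b0_min.
  have /near_unit_interval_gt : 0 < set_val t.
    by rewrite lt_neqAle eq_sym tn0 unit_interval_ge0.
  case: ifPn => [/near_unit_interval_lt tn|_] t_gt0.
    apply: filterS2 tn t_gt0 => u un u0; rewrite gt_eqF// un.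
    exact: space_le_refl.
  apply: filterS t_gt0 => u u0; rewrite gt_eqF//.
  by case: ifP => _; [exact: b0_min|exact: space_le_refl].
Qed.

Lemma unit_interval_harmonic (R : realType) n : unit_interval R (harmonic n).
Proof.
rewrite /unit_interval /= in_itv /= harmonic_ge0 /=.
by rewrite invf_le1 ?ltr0n// ler1n.
Qed.

Definition unit_harmonic (R : realType) n : unit_interval R :=
  exist _ (harmonic n) (mem_set (unit_interval_harmonic R n)).

Lemma cvg_unit_harmonic (R : realType) :
  unit_harmonic R @ \oo --> unit_interval0 R.
Proof.
move=> A [/= _ [[V oV <-] V0] VA].
have nV : nbhs (0 : R) V by exact: open_nbhs_nbhs.
have : \forall n \near \oo, V (harmonic n) by exact: (@cvg_harmonic R _ nV).
by apply: filterS => n Vn; exact: VA.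
Qed.

Lemma hurewicz_fibration_transport (R : realType) :
  finite_set [set: E] -> (exists b0 : B, forall b, space_le b0 b) ->
  hurewicz_fibration R p -> exists s, transport p s.
Proof.
move=> finE [b0 b0_min] [pc /(_ (alexandrov test_le)) hlp].
have [|||G [Gc G0 pG]] := hlp test_value (@test_homotopy R b0).
- apply: alexandrov_continuous.
  by move=> [e b n|e] [e' b' n'|e'] //= [].
- exact: test_homotopy_continuous.
- by move=> [e b n|e]; rewrite /test_homotopy //= eqxx.
have G_le x y t : test_le x y -> space_le (G (x, t)) (G (y, t)).
  move=> /(@alexandrov_space_le _ test_le) xy.
  exact: (continuous_space_le (@continuous_slicel _ _ _ G t Gc) xy).
(* The lift at [Fixed e] starts at [e], hence stays below [e] for small times; finiteness of [E]
   yields a single [n] for all [e]. *)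
have near_fixed : \forall n \near \oo, forall e,
    space_le (G (Fixed e, unit_harmonic R n)) e.
  apply: filter_forall_finite => // e.
  have := continuous_near_space_le finE (@continuous_slicer _ _ _ G (Fixed e) Gc)
    (unit_interval0 R).
  rewrite /= G0 => fixed_le; exact: (cvg_unit_harmonic fixed_le).
have [n nfixed] := filter_ex near_fixed.
exists (fun e b => G (Moving e b n, unit_harmonic R n)); split.
- by move=> e e' b b' ee' bb'; exact: G_le.
- move=> e b; have n_gt0 : 0 < set_val (unit_harmonic R n).
    exact: harmonic_gt0.
  by rewrite pG /test_homotopy /= (gt_eqF n_gt0) ltxx.
(* [Moving e (p e) n] lies below [Fixed e] in the test space. *)
- move=> e; apply: space_le_trans (nfixed e) _; apply: G_le.
  by split; exact: space_le_refl.
Qed.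

End TestSpace.

(** * Transports and Grothendieck bifibrations *)

Section Bifibration.
Context {E B : topologicalType} (p : E -> B) (pc : continuous p).

(** Monotonicity gives both universal properties: if [e'' <= e] and [p e'' <= b], then
    [e'' = s e'' (p e'') <= s e b], and dually. Equations between arrows hold by proof
    irrelevance. *)
Lemma transport_bifibration (s : E -> B -> E) :
  transport p s -> (forall e, s e (p e) = e) ->
  grothendieck_bifibration (space_functor pc).
Proof.
move=> [s_le ps _] s_id; split=> e b f.
  have se : space_le (s e b) e.
    by rewrite -{2}(s_id e); apply: s_le f; exact: space_le_refl.
  exists (s e b), (ps e b), se; split; last first.
    exact: (@Prop_irrelevance (space_le _ _)).
  move=> e'' g h _; have e''s : space_le e'' (s e b).
    by rewrite -(s_id e''); apply: s_le g _; rewrite -(ps e b).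
  by exists e''s; split=> [|? _]; [split|]; exact: (@Prop_irrelevance (space_le _ _)).
have es : space_le e (s e b).
  by rewrite -{1}(s_id e); apply: s_le f; exact: space_le_refl.
exists (s e b), (ps e b), es; split; last first.
  exact: (@Prop_irrelevance (space_le _ _)).
move=> e'' g h _; have se'' : space_le (s e b) e''.
  by rewrite -(s_id e''); apply: s_le g _; rewrite -(ps e b).
by exists se''; split=> [|? _]; [split|]; exact: (@Prop_irrelevance (space_le _ _)).
Qed.

Lemma bifibration_transport :
  (exists b0 : B, forall b, space_le b0 b) ->
  grothendieck_bifibration (space_functor pc) -> exists s, transport p s.
Proof.
move=> [b0 b0_min] [fib opfib].
(* The cartesian lift of [b0 <= p e], tested on the fiber over [b0]: [pull e] is the largest point
   of that fiber below [e]. *)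
have /choice[pull pullP] e : exists w, [/\ p w = b0, space_le w e &
    forall e', space_le e' e -> p e' = b0 -> space_le e' w].
  have [w [pw [we [we_cart _]]]] := fib e b0 (b0_min (p e)).
  have {}pw : p w = b0 by exact: pw.
  exists w; split=> // e' e'e pe'.
  have h : space_le (p e') (p w) by rewrite pe' pw.
  by have [|e'w _] := we_cart e' e'e h; first exact: (@Prop_irrelevance (space_le _ _)).
(* The opcartesian lift, as a least point above. The guard [p eb.1 = b0] ensures that there is an
   arrow to lift; elsewhere the value [w] is a dummy. *)
have /choice[push pushP] (eb : E * B) :
    exists z, p eb.1 = b0 -> [/\ p z = eb.2, space_le eb.1 z &
      forall e', space_le eb.1 e' -> space_le eb.2 (p e') -> space_le z e'].
  case: eb => w b /=; have [pw|npw] := pselect (p w = b0); last by exists w.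
  have wb : space_le (p w) b by rewrite pw.
  have [z [pz [wz [wz_cart _]]]] := opfib w b wb.
  have {}pz : p z = b by exact: pz.
  exists z => _; split=> // e' we' be'.
  have h : space_le (p z) (p e') by rewrite pz.
  by have [|ze' _] := wz_cart e' we' h; first exact: (@Prop_irrelevance (space_le _ _)).
exists (fun e b => push (pull e, b)); split=> [e e' b b' ee' bb'|e b|e].
- have [pe pee peP] := pullP e; have [pe' pee' pe'P] := pullP e'.
  have [_ _] := pushP (pull e, b) pe; apply=> /=.
    have [_ /= le' _] := pushP (pull e', b') pe'.
    apply: space_le_trans le' _; apply: pe'P => //.
    exact: space_le_trans ee' pee.
  by have [/= -> _ _] := pushP (pull e', b') pe'.
- by have [pe _ _] := pullP e; have [] := pushP (pull e, b) pe.
(* [e] is itself above [pull e] and over [p e], so minimality of the pushforward puts it below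
   [e]. *)
- have [pe pee _] := pullP e; have [_ _] := pushP (pull e, p e) pe.
  by apply.
Qed.

End Bifibration.

(** * Retraction onto dbp-retracts, and rigidity without down beat points *)

Section Retract.
Context {E B : topologicalType} (p : E -> B).

(** Each removed [e] is sent to the maximum [m] of the points below it. The beat point condition in
    the fiber supplies [m' < e] over [p e]; then [m' <= m <= e] forces [p m = p e]. *)
Lemma dbp_retract_retraction (A : set E) :
  kolmogorov_space B -> continuous p -> dbp_retract p setT A ->
  exists r : E -> A, [/\ forall x y, space_le x y -> space_le (r x) (r y),
    forall x, space_le (set_val (r x)) x & forall x, p (set_val (r x)) = p x].
Proof.
move=> T0B pc.
suff retr : dbp_retract p setT A ->
  exists r : E -> E, [/\ forall x y, space_le x y -> space_le (r x) (r y),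
    forall x, A (r x), forall x, space_le (r x) x & forall x, p (r x) = p x].
  move=> /retr[r [r_le rA r_dec pr]].
  exists (fun x => exist _ (r x) (mem_set (rA x))).
  by split=> // x y xy; apply/space_le_val; exact: r_le.
elim=> [|A' e _ [r [r_le rA' r_dec pr]] [[m [[me nme] mP]] [m' [[m'e nm'e] _]]]].
  by exists id; split=> // x; exact: space_le_refl.
pose mE := set_val m; pose eE := set_val e; pose m'E := set_val (set_val m').
have meE : space_le mE eE by exact/space_le_val.
have m'm : space_le m'E mE.
  apply/space_le_val; apply: mP; split; first exact: (space_le_val _ _).1 m'e.
  by move=> m'E_e; apply: nm'e; exact: val_inj.
have pm : p mE = p eE.
  apply: space_le_anti => //; first exact: continuous_space_le.
  have <- : p m'E = p eE by exact: set_valP m'.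
  exact: continuous_space_le.
exists (fun x => if r x == eE then mE else r x); split=> [x y xy|x|x|x].
- have rxy := r_le _ _ xy; case: eqP => [rx|nrx]; case: eqP => [ry|nry].
  + exact: space_le_refl.
  + by apply: space_le_trans rxy _; rewrite rx.
  + pose rx : A' := exist _ (r x) (mem_set (rA' x)).
    apply: ((space_le_val rx m).1); apply: mP; split.
      by apply/space_le_val; rewrite /= -/eE -ry.
    by move=> rxe; apply: nrx; rewrite /eE -rxe.
  + exact: rxy.
- case: eqP => [_|nrx]; last by split=> //; exact: rA'.
  split; first exact: set_valP.
  by move=> mE_e; apply: nme; exact: val_inj.
- case: eqP => [rx|_]; last exact: r_dec.
  by apply: space_le_trans meE; rewrite -rx; exact: r_dec.
- by case: eqP => [rx|_]; [rewrite pm -rx|]; exact: pr.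
Qed.

(** By induction on the number of points strictly below [x], [phi] fixes all of them. If [phi x]
    differed from [x], monotonicity would make it their maximum, and it lies in the fiber of [x], so
    [x] would be a down beat point of [p]. *)
Lemma decreasing_map_id (phi : E -> E) :
  finite_set [set: E] -> kolmogorov_space E ->
  (forall e, ~ map_down_beat_point p e) ->
  (forall x y, space_le x y -> space_le (phi x) (phi y)) ->
  (forall x, space_le (phi x) x) -> (forall x, p (phi x) = p x) ->
  forall x, phi x = x.
Proof.
move=> finE T0E nbp phi_le phi_dec pphi x.
have fin (A : set E) : finite_set A by exact: sub_finite_set finE.
have [n] := ubnP #|` fset_set [set y | space_lt y x]|.
elim: n x => // n IH x; rewrite ltnS => cx.
have below y : space_lt y x -> phi y = y.
  move=> [yx nyx]; apply: IH; apply: leq_trans cx.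
  apply: fproper_ltn_card; rewrite fproperEneq; apply/andP; split.
    apply/eqP => /(congr1 (fun X => y \in X)).
    rewrite !in_fset_set// [RHS]mem_set//= => /set_mem [_]; exact.
  apply/fsubsetP => z; rewrite !in_fset_set// !inE => -[zy nzy].
  split; first exact: space_le_trans zy.
  by move=> zx; apply: nyx; apply: space_le_anti => //; rewrite -zx.
apply: contrapT => nphix; apply: (nbp x).
have phi_lt : space_lt (phi x) x by split.
have phi_max y : space_lt y x -> space_le y (phi x).
  by move=> yx; rewrite -(below y yx); apply: phi_le; case: yx.
split; first by exists (phi x).
exists (exist _ (phi x) (mem_set (pphi x : fiber p (p x) (phi x)))); split.
  split; first by apply/space_le_val; exact: phi_dec.
  by move=> /(congr1 set_val).
move=> y [yx nyx]; apply/space_le_val; apply: phi_max; split.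
  exact: (space_le_val _ _).1 yx.
by move=> y_x; apply: nyx; exact: val_inj.
Qed.

End Retract.

(** Removing such an [e] would give a dbp-retract having [A] as a dbp-retract, so [A] would lie
    inside [A] minus [e]. *)
Lemma smallest_dbp_retract_no_dbp (E B : topologicalType) (p : E -> B)
    (A : set E) (e : A) :
  is_smallest_dbp_retract p A -> ~ map_down_beat_point (restr p A) e.
Proof.
move=> [pA A_min] he.
have /A_min/dbp_retract_sub : dbp_retract p setT (A `\ set_val e).
  exact: dbp_retract_step.
by move=> /(_ _ (set_valP e)) [_]; apply.
Qed.

Lemma kolmogorov_subspace (T : topologicalType) (A : set T) :
  kolmogorov_space T -> kolmogorov_space A.
Proof.
move=> T0 x y xy; have [|V] := T0 (set_val x) (set_val y).
  by apply: contra_neq xy => /val_inj.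
rewrite !inE => V_xy; exists (set_val @^-1` V); rewrite !inE.
case: V_xy => -[nV nVN]; [left|right]; split=> //.
  exact: (@initial_continuous _ _ _ x _ nV).
exact: (@initial_continuous _ _ _ y _ nV).
Qed.

Theorem theorem6p25 (R : realType) (E B : topologicalType)
    (finE : finite_set [set: E]) (finB : finite_set [set: B])
    (T0E : kolmogorov_space E) (T0B : kolmogorov_space B)
    (E_neq0 : [set: E] !=set0)
    (p : E -> B) (pc : continuous p)
    (B_min : exists b0 : B, forall b : B, space_le b0 b) :
  hurewicz_fibration R p <->
  grothendieck_bifibration
    (space_functor (restr_continuous (smallest_dbp_retract p) pc)).
Proof.
have A_small := smallest_dbp_retractP p finE T0E.
set A := smallest_dbp_retract p in A_small *.
have [r [r_le r_dec pr]] := dbp_retract_retraction T0B pc A_small.1.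
have finA : finite_set [set: A].
  by apply: (finite_preimage _ finE) => x y _ _; exact: val_inj.
split=> [hp|bifib].
- have [s [s_le ps s_counit]] := hurewicz_fibration_transport finE B_min hp.
  (* [r] brings the result back into [A] without changing its image, and only moves it down. *)
  pose sA (a : A) b := r (s (set_val a) b).
  have sA_transport : transport (restr p A) sA.
    split=> [a a' b b' aa' bb'|a b|a].
    + by apply: r_le; apply: s_le => //; exact: (space_le_val _ _).1 aa'.
    + by rewrite /restr /sA pr ps.
    + by apply/space_le_val; apply: space_le_trans (s_counit _) (r_dec _).
  apply: (transport_bifibration (restr_continuous A pc) sA_transport).
  have [sA_le psA sA_counit] := sA_transport.
  (* The map sending [a] to [sA a (p a)] is monotone, decreasing and over [B], hence the identity on
     [A]. *)
  apply: (@decreasing_map_id _ _ (restr p A)) => //.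
  + exact: kolmogorov_subspace.
  + by move=> e; exact: smallest_dbp_retract_no_dbp.
  + move=> x y xy; apply: sA_le => //.
    exact: (continuous_space_le (restr_continuous A pc)).
- have [s [s_le ps s_counit]] := bifibration_transport B_min bifib.
  (* Transport on [E] first retracts [e] to [r e], which lies below [e] in the same fiber. *)
  apply: (@transport_hurewicz_fibration _ _ _ _
    (fun e b => set_val (s (r e) b))) => //; split=> [e e' b b' ee' bb'|e b|e].
  + by apply/space_le_val; apply: s_le => //; exact: r_le.
  + exact: ps.
  + apply: space_le_trans (r_dec e) _; apply/space_le_val.
    by rewrite -(pr e); exact: s_counit.
Qed.
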